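(* Let $n \ge 2$ and, for $2 \le i \le n$, put $\sigma_i := \sigma_{1,i} \in J_n$, where $J_n$ is the cactus group. Then $J_n$ is generated by $\{\sigma_i \mid i = 2,3,\dots,n\}$ subject to the following relations (i.e. these generators and relations form a presentation of $J_n$): \begin{align*} &\sigma_i^2 = 1 && \text{for } 2 \le i \le n,\\ &(\sigma_k\sigma_i\sigma_k\sigma_j)^2 = 1 && \text{for } 4 \le i+j \le k \le n,\ 2 \le i \le j,\\ &\sigma_k\sigma_{i+j}\sigma_j\sigma_{i+j} = \sigma_{k-i}\sigma_j\sigma_{k-i}\sigma_k && \text{for } 3 \le i+j < k \le n,\ 1 \le i,\ 2 \le j,\ i+j \le k-i. \end{align*} Further, this presentation is minimal in terms of the number of generators, i.e. $J_n$ has no presentation with fewer than $n-1$ generators.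
   Context: For integers $p<q$ write $[p,q]=\{p,p+1,\dots,q\}$. For $n\ge 2$ the cactus group $J_n$ is the group generated by $\{\sigma_{p,q} \mid 1\le p<q\le n\}$ with defining relations (1) $\sigma_{p,q}^2=1$ for $1\le p<q\le n$; (2) $\sigma_{p,q}\sigma_{r,s}=\sigma_{r,s}\sigma_{p,q}$ whenever $[p,q]\cap[r,s]=\emptyset$; (3) $\sigma_{p,q}\sigma_{r,s}=\sigma_{p+q-s,\,p+q-r}\,\sigma_{p,q}$ whenever $[r,s]\subset[p,q]$. *)

(* Defs.v *)
From HB Require Import structures.
From mathcomp Require Import all_boot boolp.

Set Implicit Arguments.
Unset Strict Implicit.
Unset Printing Implicit Defensive.

Local Open Scope quotient_scope.

(* Group words: the pair (x, false) is the letter x, and (x, true) its formal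
   inverse. The product of two words is their concatenation. *)
Definition word (X : Type) : Type := seq (X * bool).

Section PresentedGroup.
Variables (X : choiceType) (R : word X -> word X -> Prop).

(* [R u v] reads as the defining relation u = v; [wcong] is the congruence on
   words whose classes are the elements of the group < X | R >. *)
Inductive wcong : word X -> word X -> Prop :=
| wcong_rel u v : R u v -> wcong u v
| wcong_cancel x b : wcong [:: (x, b); (x, ~~ b)] [::]
| wcong_refl u : wcong u u
| wcong_sym u v : wcong u v -> wcong v u
| wcong_trans u v w : wcong u v -> wcong v w -> wcong u w
| wcong_cat u u' v v' : wcong u u' -> wcong v v' -> wcong (u ++ v) (u' ++ v').

Definition wcongb : rel (seq (X * bool)) := fun u v => `[< wcong u v >].

Lemma wcongb_equiv : equiv_class_of wcongb.
Proof.
split.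
- by move=> u; apply/asboolP; apply: wcong_refl.
- by move=> u v; apply/asboolP/asboolP; apply: wcong_sym.
- move=> v u w /asboolP uv /asboolP vw; apply/asboolP.
  exact: wcong_trans uv vw.
Qed.

Canonical wcongb_equiv_rel := EquivRelPack wcongb_equiv.

Definition presented : Type := {eq_quot wcongb_equiv_rel}.

HB.instance Definition _ := Choice.on presented.
HB.instance Definition _ := EqQuotient.on presented.

Definition wclass (w : word X) : presented := \pi_presented w.

Lemma wclassP (u v : word X) : wclass u = wclass v <-> wcong u v.
Proof.
split=> [/eqP|uv]; first by rewrite /wclass piE => /asboolP.
by apply/eqP; rewrite /wclass piE; apply/asboolP.
Qed.

Definition winv (w : word X) : word X := rev [seq (a.1, ~~ a.2) | a <- w].

Definition presented_one : presented := wclass [::].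
Definition presented_mul (g h : presented) : presented :=
  wclass ((repr g : word X) ++ repr h).
Definition presented_inv (g : presented) : presented := wclass (winv (repr g)).

Lemma repr_wclass (w : word X) : wcong (repr (wclass w)) w.
Proof. by apply/wclassP; rewrite /wclass reprK. Qed.

Lemma wclass_repr (g : presented) : wclass (repr g) = g.
Proof. exact: reprK. Qed.

Lemma wclass_cat (u v : word X) :
  presented_mul (wclass u) (wclass v) = wclass (u ++ v).
Proof. by apply/wclassP; apply: wcong_cat; apply: repr_wclass. Qed.

Lemma winvK : involutive winv.
Proof.
move=> w; rewrite /winv map_rev revK -map_comp.
by rewrite -[RHS]map_id; apply: eq_map => -[x b] /=; rewrite negbK.
Qed.

Lemma wcong_winvr (w : word X) : wcong (w ++ winv w) [::].
Proof.
elim: w => [|[x b] w IHw]; first exact: wcong_refl.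
have -> : ((x, b) :: w) ++ winv ((x, b) :: w)
          = [:: (x, b)] ++ (w ++ winv w) ++ [:: (x, ~~ b)].
  by rewrite /winv /= rev_cons -cats1 !catA.
apply: wcong_trans (wcong_cancel x b).
rewrite -[in X in wcong _ X](cat1s (x, b)) -{2}[[:: (x, ~~ b)]]cat0s.
apply: wcong_cat; first exact: wcong_refl.
by apply: wcong_cat; [exact: IHw | exact: wcong_refl].
Qed.

Lemma wcong_winvl (w : word X) : wcong (winv w ++ w) [::].
Proof. by rewrite -{2}[w]winvK; apply: wcong_winvr. Qed.

Lemma presented_mulA : associative presented_mul.
Proof.
move=> g h k; rewrite -[g]wclass_repr -[h]wclass_repr -[k]wclass_repr.
by rewrite !wclass_cat catA.
Qed.

Lemma presented_mul1 : left_id presented_one presented_mul.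
Proof. by move=> g; rewrite -[g]wclass_repr wclass_cat. Qed.

Lemma presented_mulr1 : right_id presented_one presented_mul.
Proof. by move=> g; rewrite -[g]wclass_repr wclass_cat cats0. Qed.

Lemma presented_mulV : left_inverse presented_one presented_inv presented_mul.
Proof.
move=> g; rewrite /presented_inv -{2}[g]wclass_repr wclass_cat.
by apply/wclassP; apply: wcong_winvl.
Qed.

Lemma presented_mulrV : right_inverse presented_one presented_inv presented_mul.
Proof.
move=> g; rewrite /presented_inv -{1}[g]wclass_repr wclass_cat.
by apply/wclassP; apply: wcong_winvr.
Qed.

HB.instance Definition _ := isGroup.Build presented
  presented_mulA presented_mul1 presented_mulr1 presented_mulV presented_mulrV.

Definition pgen (x : X) : presented := wclass [:: (x, false)].

End PresentedGroup.

(* < X | R > is a presentation of G, with x : X standing for s x: the map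
   x |-> s x induces an isomorphism from < X | R > onto G. *)
Definition presents (X : choiceType) (R : word X -> word X -> Prop)
    (G : groupType) (s : X -> G) : Prop :=
  exists2 f : {multiplicative presented R -> G},
    bijective f & forall x : X, f (pgen R x) = s x.

(* The one-letter word x when P x holds. The default value, the empty word, is
   never used in the relations below: their side conditions put every index in
   range, and make every natural subtraction exact. *)
Definition letter (T : Type) (P : pred T) (x : T) : word {x : T | P x} :=
  if insub x is Some y then [:: (y, false)] else [::].

Definition itv (p q : nat) : pred nat := [pred x | p <= x <= q].

Definition cactus_idx (n : nat) : pred (nat * nat) :=
  [pred pq | [&& 1 <= pq.1, pq.1 < pq.2 & pq.2 <= n]].

Section Cactus.
Variable n : nat.
Local Notation s p q := (letter (cactus_idx n) (p, q)).

Inductive cactus_rel : word {pq : nat * nat | cactus_idx n pq} ->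
                       word {pq : nat * nat | cactus_idx n pq} -> Prop :=
| cactus_sqr p q of cactus_idx n (p, q) :
    cactus_rel (s p q ++ s p q) [::]
| cactus_comm p q p' q' of cactus_idx n (p, q) & cactus_idx n (p', q')
    & [predI itv p q & itv p' q'] =i pred0 :
    cactus_rel (s p q ++ s p' q') (s p' q' ++ s p q)
| cactus_nest p q p' q' of cactus_idx n (p, q) & cactus_idx n (p', q')
    & {subset itv p' q' <= itv p q} :
    cactus_rel (s p q ++ s p' q') (s (p + q - q') (p + q - p') ++ s p q).

Definition cactus : groupType := presented cactus_rel.

Definition csigma (p q : nat) : cactus := wclass cactus_rel (s p q).

End Cactus.

Definition prefix_idx (n : nat) : pred nat := [pred i | 2 <= i <= n].

Section Prefix.
Variable n : nat.
Local Notation s i := (letter (prefix_idx n) i).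

Inductive prefix_rel : word {i : nat | prefix_idx n i} ->
                       word {i : nat | prefix_idx n i} -> Prop :=
| prefix_sqr i of 2 <= i <= n :
    prefix_rel (s i ++ s i) [::]
| prefix_comm i j k of 4 <= i + j & i + j <= k <= n & 2 <= i <= j :
    prefix_rel ((s k ++ s i ++ s k ++ s j) ++ (s k ++ s i ++ s k ++ s j)) [::]
| prefix_conj i j k of 3 <= i + j & i + j < k <= n & 1 <= i & 2 <= j
    & i + j <= k - i :
    prefix_rel (s k ++ s (i + j) ++ s j ++ s (i + j))
               (s (k - i) ++ s j ++ s (k - i) ++ s k).

End Prefix.

(* Main.v *)
From HB Require Import structures.
Require Import Defs.
From mathcomp Require Import all_boot.
From mathcomp Require Import all_algebra all_fingroup all_solvable all_character.
From mathcomp Require Import zify.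

Set Implicit Arguments.
Unset Strict Implicit.
Unset Printing Implicit Defensive.

Local Open Scope group_scope.

(** Write a i for the prefix generator sigma_i.  In the cactus group the nesting
    relation for [p,q] inside [1,q] says that conjugation by sigma_{1,q} flips
    [1,q], so that
      sigma_{p,q} = sigma_{1,q-p+1} ^ sigma_{1,q} ,
    and every generator is a conjugate of one prefix generator by another.  This
    formula is used as a definition in the group P presented by the prefix
    relations: put [itv_gen a p q := a (q-p+1) ^ a q].  The cactus relations
    hold for these elements.

    - All rests on the flip law [itv_gen_flip]: for q <= k, conjugation by a k
      maps [itv_gen a p q] to the element of the reflected interval
      [k+1-q, k+1-p].  When q = k or p = 1 this is formal; otherwise it is the
      third prefix relation, read directly if q <= k+1-p, and read with the
      roles of the interval and of its reflection exchanged if not.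
    - Nesting ([itv_genJ]): the reflection in [p,q] is the composite of the
      reflections in [1,q], in [1,q-p+1], and in [1,q] again, because
      [itv_gen a p q] is a conjugate of a (q-p+1) by a q.  So the flip law
      applied three times gives the general nesting relation.
    - Disjointness ([itv_genC]): two flips move disjoint intervals to a final
      segment of some [1,k] and to a prefix that ends before it; for these,
      commutation is the second prefix relation.

    Conversely the elements sigma_{1,i} satisfy the prefix relations
    ([prefix_laws_cactus]), so there are homomorphisms both ways, and they are
    inverse to each other since they are so on generators.

    For minimality, each cactus relation preserves the lengths of the intervals
    of its letters, up to squares and order.  Hence the parities of the numbers
    of letters of each length define a homomorphism from the cactus group onto
    F_2^(n-1) ([cactus_length], [cactus_length_surj]), which is elementary
    abelian of rank n-1 and so cannot be generated by fewer elements. *)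

(** * Evaluating words, and the universal property of a presentation *)

Section Evaluation.
Variables (X : choiceType) (G : groupType) (s : X -> G).

Definition weval (w : word X) : G :=
  \prod_(a <- w) (if a.2 then (s a.1)^-1 else s a.1).

Lemma weval_nil : weval [::] = 1.
Proof. exact: big_nil. Qed.

Lemma weval_cat u v : weval (u ++ v) = weval u * weval v.
Proof. exact: big_cat. Qed.

Definition respects (R : word X -> word X -> Prop) : Prop :=
  forall u v, R u v -> weval u = weval v.

Lemma weval_wcong R u v : respects R -> wcong R u v -> weval u = weval v.
Proof.
move=> Rs; elim=> {u v} [u v /Rs // | x b | // | // | u v w _ -> _ -> // | ].
  by rewrite /weval big_cons big_seq1 big_nil; case: b; rewrite /= ?mulVg ?mulgV.
by move=> u u' v v' _ equ _ eqv; rewrite !weval_cat equ eqv.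
Qed.

(** The argument [Rs] makes the homomorphism structure on [lift Rs] inferable
    from the function alone. *)
Definition lift R (Rs : respects R) (g : presented R) : G :=
  weval (generic_quotient.repr g).

Section Lift.
Variables (R : word X -> word X -> Prop) (Rs : respects R).

Lemma lift_wclass w : lift Rs (wclass R w) = weval w.
Proof. by apply: weval_wcong Rs _; apply: repr_wclass. Qed.

Lemma lift_morph : {morph lift Rs : g h / g * h}.
Proof.
move=> g h; rewrite -[g]wclass_repr -[h]wclass_repr.
by rewrite [X in lift _ X]wclass_cat !lift_wclass weval_cat.
Qed.

Lemma lift1 : lift Rs 1 = 1.
Proof. by rewrite [LHS]lift_wclass weval_nil. Qed.

HB.instance Definition _ :=
  isUMagmaMorphism.Build (presented R) G (lift Rs) (lift1, lift_morph).

Lemma lift_pgen x : lift Rs (pgen R x) = s x.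
Proof. by rewrite lift_wclass /weval big_seq1. Qed.

End Lift.
End Evaluation.

Lemma weval_letter (T : choiceType) (P : pred T) (G : groupType)
    (s : {x : T | P x} -> G) (y : {x : T | P x}) :
  weval s (letter P (sval y)) = s y.
Proof. by rewrite /letter valK /weval big_seq1. Qed.

Lemma eq_weval (X : choiceType) (G : groupType) (s s' : X -> G) :
  s =1 s' -> weval s =1 weval s'.
Proof. by move=> eqs w; apply: eq_bigr => -[x b] _ /=; rewrite eqs. Qed.

Lemma multiplicative1 (G H : groupType) (f : {multiplicative G -> H}) : f 1 = 1.
Proof. by apply: (mulgI (f 1)); rewrite -gmulfM !mulg1. Qed.

Lemma weval_morph (X : choiceType) (G H : groupType) (s : X -> G)
    (f : {multiplicative G -> H}) (w : word X) :
  f (weval s w) = weval (f \o s) w.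
Proof.
have fV x : f x^-1 = (f x)^-1.
  by apply: (mulgI (f x)); rewrite -gmulfM !mulgV multiplicative1.
rewrite /weval (big_morph f (@gmulfM _ _ f) (multiplicative1 f)).
by apply: eq_bigr => -[x []] _ /=.
Qed.

Section Generators.
Variables (X : choiceType) (R : word X -> word X -> Prop).

Lemma wclassM u v : wclass R (u ++ v) = wclass R u * wclass R v.
Proof. by rewrite [RHS]wclass_cat. Qed.

Lemma weval_pgen w : weval (pgen R) w = wclass R w.
Proof.
elim: w => [|[x b] w IHw]; first exact: weval_nil.
rewrite -cat1s weval_cat IHw wclassM; congr (_ * _).
rewrite /weval big_seq1; case: b => //=.
apply: (mulgI (pgen R x)); rewrite mulgV -wclassM.
by apply/wclassP; apply: wcong_sym; apply: (wcong_cancel R x false).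
Qed.

Lemma respects_pgen : respects (pgen R) R.
Proof. by move=> u v Ruv; rewrite !weval_pgen; apply/wclassP/wcong_rel. Qed.

End Generators.

Lemma presented_morph_ext (X : choiceType) (R : word X -> word X -> Prop)
    (G : groupType) (f f' : {multiplicative presented R -> G}) :
  (forall x, f (pgen R x) = f' (pgen R x)) -> f =1 f'.
Proof.
move=> eqf g; rewrite -[g]wclass_repr -weval_pgen !weval_morph.
exact: eq_weval.
Qed.

(** * Conjugation by involutions *)

Lemma conj_self (G : groupType) (x : G) : x ^ x = x.
Proof. by rewrite conjgE mulKg. Qed.

(** The nesting relations and the third prefix relation all have the shape
    [c * b = d * c] with c an involution; as conjugations they compose. *)
Lemma conj_involution (G : groupType) (b c d : G) :
  c^-1 = c -> b ^ c = d <-> c * b = d * c.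
Proof.
move=> cV; have cc : c * c = 1 by rewrite -{1}cV mulVg.
rewrite conjgE cV; split=> [<- | cb]; last by rewrite mulgA cb -mulgA cc mulg1.
by rewrite -!mulgA cc mulg1.
Qed.

Lemma commuteJ (G : groupType) (x y z : G) :
  commute (x ^ z) (y ^ z) <-> commute x y.
Proof.
by rewrite /commute -(conjMg x) -(conjMg y); split=> [/conjg_inj | ->].
Qed.

(** The square of a product of two involutions, here [x ^ z] and [y], is trivial
    exactly when they commute; the word spells out [x ^ z] as z x z. *)
Lemma commute_involutions (G : groupType) (x y z : G) :
  x^-1 = x -> y^-1 = y -> z^-1 = z ->
  commute (x ^ z) y <->
    (z * (x * (z * y))) * (z * (x * (z * y))) = 1.
Proof.
move=> xV yV zV.
have -> : z * (x * (z * y)) = x ^ z * y by rewrite conjgE zV !mulgA.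
rewrite /commute; have <- : (x ^ z * y)^-1 = y * x ^ z.
  by rewrite invgM -conjVg xV yV.
by split=> [{1}-> | /mulg1_eq]; rewrite ?mulVg.
Qed.

(** * The defining relations as laws in a group *)

Record cactus_laws (n : nat) (G : groupType) (s : nat -> nat -> G) : Prop := {
  cactusV p q : 1 <= p < q -> q <= n -> (s p q)^-1 = s p q;
  cactusC p q p' q' : 1 <= p < q -> q < p' < q' -> q' <= n ->
    commute (s p q) (s p' q');
  cactusJ p q p' q' : 1 <= p -> p <= p' -> p' < q' -> q' <= q -> q <= n ->
    s p' q' ^ s p q = s (p + q - q') (p + q - p') }.

(** In conjugation form the second prefix relation is commutation of a prefix
    with a final segment of [1,k], and the third is the nesting of [i+1,i+j]
    in [1,k]. *)
Record prefix_laws (n : nat) (G : groupType) (a : nat -> G) : Prop := {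
  prefixV i : 2 <= i <= n -> (a i)^-1 = a i;
  prefixC i j k : 2 <= i <= j -> i + j <= k <= n -> commute (a i ^ a k) (a j);
  prefixJ i j k : 1 <= i -> 2 <= j -> i + j < k <= n -> i + j <= k - i ->
    (a j ^ a (i + j)) ^ a k = a j ^ a (k - i) }.

Lemma disjoint_itv p q p' q' : p < q -> p' < q' ->
  [predI itv p q & itv p' q'] =i pred0 -> q < p' \/ q' < p.
Proof.
(* Overlapping intervals share the larger of their left ends. *)
move=> lt_pq lt_pq' dis; move: (dis (maxn p p')).
by rewrite !inE; lia.
Qed.

Lemma subset_itv p q p' q' : p' < q' ->
  {subset itv p' q' <= itv p q} -> p <= p' /\ q' <= q.
Proof.
move=> lt_pq' sub; have := sub p'; have := sub q'.
by rewrite !inE; lia.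
Qed.

Section Laws.
Variables (n : nat) (G : groupType).

(** This and its analogue for the prefix relations let the two presentations be
    compared by identities between group elements, with no words involved. *)
Lemma cactus_respectsP (s : {pq : nat * nat | cactus_idx n pq} -> G) :
  respects s (@cactus_rel n)
    <-> cactus_laws n (fun p q => weval s (letter (cactus_idx n) (p, q))).
Proof.
split=> [Rs | laws u v].
  have sV p q : 1 <= p < q -> q <= n ->
      (weval s (letter (cactus_idx n) (p, q)))^-1 =
       weval s (letter (cactus_idx n) (p, q)).
    move=> lt_pq le_qn; apply: mulg1_eq; rewrite -weval_cat -(weval_nil s).
    by apply/Rs/cactus_sqr; rewrite /cactus_idx /=; lia.
  split=> [// | p q p' q' | p q p' q'].
    move=> lt_pq lt_pq' le_qn; rewrite /commute -!weval_cat.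
    apply/Rs/cactus_comm; [rewrite /cactus_idx /=; lia..|].
    by move=> x; rewrite !inE; lia.
  move=> le1p le_pp' lt_pq' le_qq' le_qn.
  apply/conj_involution; first by apply: sV; lia.
  rewrite -!weval_cat; apply/Rs/cactus_nest; [rewrite /cactus_idx /=; lia..|].
  by move=> x; rewrite !inE; lia.
case=> [p q /and3P[/= le1p lt_pq le_qn] | p q p' q' | p q p' q'].
- rewrite weval_cat weval_nil -[X in X * _](cactusV laws) ?mulVg //.
  by rewrite le1p.
- move=> /and3P[/= le1p lt_pq le_qn] /and3P[/= le1p' lt_pq' le_qn'].
  move=> /disjoint_itv; rewrite !weval_cat => /(_ lt_pq lt_pq')[] lt.
    by apply: (cactusC laws); lia.
  by symmetry; apply: (cactusC laws); lia.
move=> /and3P[/= le1p lt_pq le_qn] /and3P[/= le1p' lt_pq' le_qn'].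
move=> /(subset_itv lt_pq')[le_pp le_qq]; rewrite !weval_cat.
apply/conj_involution; first by apply: (cactusV laws); lia.
exact: (cactusJ laws).
Qed.

Lemma prefix_respectsP (s : {i : nat | prefix_idx n i} -> G) :
  respects s (@prefix_rel n)
    <-> prefix_laws n (fun i => weval s (letter (prefix_idx n) i)).
Proof.
split=> [Rs | laws u v].
  have aV i : 2 <= i <= n ->
      (weval s (letter (prefix_idx n) i))^-1 = weval s (letter (prefix_idx n) i).
    move=> lei; apply: mulg1_eq; rewrite -weval_cat -(weval_nil s).
    exact/Rs/prefix_sqr.
  split=> [// | i j k le_ij le_k | i j k le1i le2j lt_k le_k].
    apply/commute_involutions; try by apply: aV; lia.
    by rewrite -!weval_cat -(weval_nil s); apply/Rs/prefix_comm; lia.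
  apply/conj_involution; first by apply: aV; lia.
  rewrite [a' in _ * a' = _]conjgE [a' in _ = a' * _]conjgE !aV; try lia.
  rewrite -!mulgA -!weval_cat; apply/Rs/prefix_conj => //; lia.
case=> [i lei | i j k _ le_k le_ij | i j k _ lt_k le1i le2j le_k];
  rewrite !weval_cat.
- by rewrite -[X in X * _](prefixV laws) ?weval_nil ?mulVg.
- rewrite weval_nil; apply/commute_involutions.
  1-3: by apply: (prefixV laws); lia.
  exact: (prefixC laws).
have kV : 2 <= k <= n by lia.
have := prefixJ laws le1i le2j lt_k le_k.
move/(conj_involution _ _ (prefixV laws kV)).
rewrite [a' in _ * a' = _]conjgE [a' in _ = a' * _]conjgE !(prefixV laws); try lia.
by rewrite -!mulgA.
Qed.

End Laws.

Lemma cactus_laws_ext n (G : groupType) (s s' : nat -> nat -> G) :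
  (forall p q, 1 <= p < q -> q <= n -> s p q = s' p q) ->
  cactus_laws n s -> cactus_laws n s'.
Proof.
move=> eqs laws; split=> [p q lt_pq le_qn | p q p' q' lt_pq lt_pq' le_qn |].
- by rewrite -!eqs //; apply: (cactusV laws).
- by rewrite -!eqs; [apply: (cactusC laws) | lia..].
move=> p q p' q' le1p le_pp' lt_pq' le_qq' le_qn.
by rewrite -!eqs; [apply: (cactusJ laws) | lia..].
Qed.

Lemma prefix_laws_ext n (G : groupType) (a a' : nat -> G) :
  (forall i, 2 <= i <= n -> a i = a' i) -> prefix_laws n a -> prefix_laws n a'.
Proof.
move=> eqa laws; split=> [i lei | i j k le_ij le_k | i j k le1i le2j lt_k le_k].
- by rewrite -!eqa //; apply: (prefixV laws).
- by rewrite -!eqa; [apply: (prefixC laws) | lia..].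
by rewrite -!eqa; [apply: (prefixJ laws) | lia..].
Qed.

(** * The cactus relations follow from the prefix relations *)

Section CactusFromPrefix.
Variables (n : nat) (G : groupType).
Variable a : nat -> G.
Hypothesis laws : prefix_laws n a.

(** The formula for sigma_{p,q} in terms of prefix generators: [p,q] is the
    mirror image in [1,q] of the prefix [1,q-p+1]. *)
Definition itv_gen (p q : nat) : G := a (q - p).+1 ^ a q.

Lemma conj_genK i : 2 <= i <= n -> involutive (conjg^~ (a i)).
Proof. by move=> lei x; rewrite -{2}(prefixV laws lei) conjgK. Qed.

Lemma itv_gen1 q : 1 < q -> itv_gen 1 q = a q.
Proof. by move=> lt1q; rewrite /itv_gen subn1 prednK ?conj_self //; lia. Qed.

(** The boundary cases q = k and p = 1 hold because the a i are involutions and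
    [x ^ x = x].  Otherwise this is the third prefix relation with i = p-1, whose
    condition i+j <= k-i reads q <= k+1-p; when that fails, the reflected
    interval [k+1-q, k+1-p] satisfies it, and conjugating back by a k gives the
    claim. *)
Lemma itv_gen_flip p q k : 1 <= p < q -> q <= k <= n ->
  itv_gen p q ^ a k = itv_gen (k.+1 - q) (k.+1 - p).
Proof.
rewrite /itv_gen => lt_pq le_qk.
have -> : ((k.+1 - p) - (k.+1 - q)).+1 = (q - p).+1 by lia.
have [eqk | neqk] := eqVneq q k.
  rewrite eqk conj_genK; last by lia.
  have -> : k.+1 - p = (k - p).+1 by lia.
  by rewrite conj_self.
have [eqp | neqp] := eqVneq p 1%N.
  have -> : (q - p).+1 = q by lia.
  by rewrite conj_self; congr (_ ^ a _); lia.
have [le | lt] := leqP q (k.+1 - p).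
  have := prefixJ laws (i := p.-1) (j := (q - p).+1) (k := k).
  have -> : p.-1 + (q - p).+1 = q by lia.
  have -> : k - p.-1 = k.+1 - p by lia.
  by apply; lia.
have := prefixJ laws (i := k - q) (j := (q - p).+1) (k := k).
have -> : k - q + (q - p).+1 = k.+1 - p by lia.
have -> : k - (k - q) = q by lia.
move=> <-; [|lia..].
by rewrite conj_genK; last by lia.
Qed.

(** Conjugation by a conjugate [y ^ z] is conjugation by z^-1, y and z in turn,
    so the flip law is used for the intervals [1,q], [1,q-p+1] and [1,q]. *)
Lemma itv_genJ p q p' q' : 1 <= p -> p <= p' -> p' < q' -> q' <= q -> q <= n ->
  itv_gen p' q' ^ itv_gen p q = itv_gen (p + q - q') (p + q - p').
Proof.
move=> le1p le_pp lt_pq le_qq le_qn.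
rewrite {2}/itv_gen.
have -> (x y z : G) : x ^ (y ^ z) = ((x ^ z^-1) ^ y) ^ z.
  by rewrite -!conjgM conjgE; congr (_ ^ _); rewrite !mulgA.
rewrite (prefixV laws); last by lia.
rewrite !itv_gen_flip //; try lia.
by congr itv_gen; lia.
Qed.

(** Flipping in [1,q'] makes [p',q'] a prefix and sends [p,q] to an interval
    with right end k = q'+1-p; flipping in [1,k] then makes the latter a prefix
    and the former a final segment of [1,k]. *)
Lemma itv_genC p q p' q' : 1 <= p < q -> q < p' < q' -> q' <= n ->
  commute (itv_gen p q) (itv_gen p' q').
Proof.
move=> lt_pq lt_pq' le_qn.
pose i := (q - p).+1; pose m := (q' - p').+1; pose k := q'.+1 - p.
apply/(commuteJ _ _ (a q'))/(commuteJ _ _ (a k)).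
rewrite ![_ ^ a q']itv_gen_flip; try lia.
rewrite subSnn.
rewrite !itv_gen_flip; try lia.
have -> : k.+1 - k = 1%N by lia.
have -> : k.+1 - (q'.+1 - q) = i by lia.
have -> : q'.+1 - p' = m by lia.
have -> : (k.+1 - 1)%N = k by lia.
rewrite itv_gen1 /itv_gen; last by lia.
have -> : (k - (k.+1 - m)).+1 = m by lia.
(* The second prefix relation orders its two lengths; the other order is
   obtained on conjugating by the involution a k. *)
have [le_im | lt_mi] := leqP i m; last first.
  by apply/commute_sym/(prefixC laws); lia.
apply/(commuteJ _ _ (a k)); rewrite conj_genK; last by lia.
by apply: (prefixC laws); lia.
Qed.

Lemma cactus_laws_itv_gen : cactus_laws n itv_gen.
Proof.
split; [|exact: itv_genC|exact: itv_genJ].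
move=> p q lt_pq le_qn; rewrite -conjVg (prefixV laws) //; lia.
Qed.
End CactusFromPrefix.

(** * The prefix relations follow from the cactus relations *)

Section PrefixFromCactus.
Variables (n : nat) (G : groupType) (s : nat -> nat -> G).
Hypothesis laws : cactus_laws n s.

Lemma cactus_itv_gen p q : 1 <= p < q -> q <= n -> s p q = itv_gen (s 1%N) p q.
Proof.
move=> lt_pq le_qn; rewrite /itv_gen (cactusJ laws); try lia.
by congr s; lia.
Qed.

Lemma prefix_laws_cactus : prefix_laws n (s 1%N).
Proof.
split=> [i lei | i j k le_ij le_k | i j k le1i le2j lt_k le_k].
- by rewrite (cactusV laws) //; lia.
- rewrite (cactusJ laws); try lia.
  by apply/esym/(cactusC laws); lia.
rewrite !(cactusJ laws); try lia.
by congr s; lia.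
Qed.
End PrefixFromCactus.

(** * The prefix presentation *)

(** The universal property gives f from the prefix presentation, by
    sigma_i |-> sigma_{1,i}, and g from the cactus group, by the formula of
    [itv_gen].  On generators, g after f is the identity because [1,i] is its own
    mirror image, and f after g because the formula holds in the cactus group. *)
Lemma prefix_presents_cactus n :
  presents (@prefix_rel n) (fun i : {i | prefix_idx n i} => csigma n 1 (sval i)).
Proof.
have Jlaws : cactus_laws n (csigma n).
  have := (cactus_respectsP _).1 (@respects_pgen _ (@cactus_rel n)).
  by apply: cactus_laws_ext => p q _ _; apply: weval_pgen.
pose s (i : {i | prefix_idx n i}) := csigma n 1 (sval i).
have sE i : 2 <= i <= n -> weval s (letter (prefix_idx n) i) = csigma n 1 i.
  by move=> lei; apply: (weval_letter s (exist _ i lei)).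
have Rs : respects s (@prefix_rel n).
  apply/prefix_respectsP; apply: prefix_laws_ext (prefix_laws_cactus Jlaws) => i.
  by move=> lei; rewrite sE.
pose a i := wclass (@prefix_rel n) (letter (prefix_idx n) i).
have Plaws : prefix_laws n a.
  have := (prefix_respectsP _).1 (@respects_pgen _ (@prefix_rel n)).
  by apply: prefix_laws_ext => i _; apply: weval_pgen.
pose r (pq : {pq | cactus_idx n pq}) := itv_gen a (sval pq).1 (sval pq).2.
have rE p q : 1 <= p < q -> q <= n ->
    weval r (letter (cactus_idx n) (p, q)) = itv_gen a p q.
  move=> lt_pq le_qn.
  have idx: cactus_idx n (p, q) by rewrite /cactus_idx /=; lia.
  exact: (weval_letter r (exist _ (p, q) idx)).
have Rr : respects r (@cactus_rel n).
  apply/cactus_respectsP; apply: cactus_laws_ext (cactus_laws_itv_gen Plaws) => p q.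
  by move=> lt_pq le_qn; rewrite rE.
have fa i : 2 <= i <= n -> lift Rs (a i) = csigma n 1 i.
  by move=> lei; rewrite -sE //; apply: lift_wclass.
have gs p q : 1 <= p < q -> q <= n -> lift Rr (csigma n p q) = itv_gen a p q.
  by move=> lt_pq le_qn; rewrite -rE //; apply: lift_wclass.
have pgenP i (lei : prefix_idx n i) : pgen (@prefix_rel n) (exist _ i lei) = a i.
  by rewrite /a -weval_pgen; apply/esym/(weval_letter _ (exist _ i lei)).
have pgenJ p q (idx : cactus_idx n (p, q)) :
    pgen (@cactus_rel n) (exist _ (p, q) idx) = csigma n p q.
  by rewrite /csigma -weval_pgen; apply/esym/(weval_letter _ (exist _ (p, q) idx)).
pose f : {multiplicative presented (@prefix_rel n) -> cactus n} := lift Rs.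
exists f; last by move=> i; exact: lift_pgen.
apply: (Bijective (g := lift Rr)).
  apply: (@presented_morph_ext _ _ _ (lift Rr \o lift Rs) idfun) => -[i lei].
  have /andP[lt1i le_in] := lei.
  by rewrite pgenP /= fa // gs // itv_gen1.
apply: (@presented_morph_ext _ _ _ (lift Rs \o lift Rr) idfun) => -[[p q] idx].
have /and3P[/= le1p lt_pq le_qn] := idx.
rewrite pgenJ /= gs ?le1p // gmulfJ /= !fa; [|lia..].
by rewrite [RHS](cactus_itv_gen Jlaws) ?le1p.
Qed.

(** * The number of generators *)

Lemma presents_generators (X : finType) (R : word X -> word X -> Prop)
    (G : groupType) (t : X -> G) (gT : finGroupType) (f : {multiplicative G -> gT}) :
  presents R t -> (forall z, exists g, f g = z) ->
  <<[set f (t x) | x : X]>> = [set: gT].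
Proof.
move=> [h [h' _ h'K] hgen] surj; apply/setP=> z; rewrite inE.
have [g <-] := surj z; rewrite -[g]h'K -[h' g]wclass_repr -weval_pgen.
rewrite !weval_morph; apply: group_prod => -[x b] _ /=; rewrite hgen.
have fx : f (t x) \in <<[set f (t x) | x : X]>>.
  by apply: mem_gen; apply: imset_f.
by case: b; rewrite ?groupV.
Qed.

(** The basis vector attached to the intervals [p,q] with q - p = k, provided
    that 1 <= k <= m. *)
Definition length_class (m : nat) (k : nat) : 'rV['F_2]_m :=
  \row_(j < m) (k == j.+1)%:R%R.

(** In an elementary abelian 2-group the nesting relation only requires that the
    two nested intervals have equal length, which reflection ensures. *)
Lemma cactus_laws_length n : cactus_laws n (fun p q => length_class (n - 1) (q - p)).
Proof.
have addE (u v : 'rV['F_2]_(n - 1)) : u * v = (u + v)%R by [].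
split=> [p q _ _ | p q p' q' _ _ _ | p q p' q' le1p le_pp' lt_pq' le_qq' le_qn].
- apply: mulg1_eq; rewrite addE; apply/matrixP=> i j; rewrite !mxE.
  by case: (q - p == j.+1)%N; apply: val_inj.
- exact: GRing.addrC.
rewrite conjgE mulgA addE GRing.addrC -addE mulgA mulgV mul1g.
by congr length_class; lia.
Qed.

Lemma cactus_length n :
  exists f : {multiplicative cactus n -> 'rV['F_2]_(n - 1)},
    forall p q, 1 <= p < q -> q <= n ->
      f (csigma n p q) = length_class (n - 1) (q - p).
Proof.
pose s (pq : {pq | cactus_idx n pq}) :=
  length_class (n - 1) ((sval pq).2 - (sval pq).1).
have sE p q : 1 <= p < q -> q <= n ->
    weval s (letter (cactus_idx n) (p, q)) = length_class (n - 1) (q - p).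
  move=> lt_pq le_qn.
  have idx: cactus_idx n (p, q) by rewrite /cactus_idx /=; lia.
  exact: (weval_letter s (exist _ (p, q) idx)).
have Rs : respects s (@cactus_rel n).
  apply/cactus_respectsP; apply: cactus_laws_ext (cactus_laws_length n) => p q.
  by move=> lt_pq le_qn; rewrite sE.
exists (lift Rs) => p q lt_pq le_qn; rewrite -sE //.
exact: lift_wclass.
Qed.

(** The intervals [1,j+2] with j < n-1 realize all the basis vectors. *)
Lemma cactus_length_surj n (f : {multiplicative cactus n -> 'rV['F_2]_(n - 1)}) :
  (forall p q, 1 <= p < q -> q <= n ->
    f (csigma n p q) = length_class (n - 1) (q - p)) ->
  forall z, exists g, f g = z.
Proof.
move=> fE z.
exists (\prod_(j < n - 1) csigma n 1 j.+2 ^+ (z ord0 j : nat)).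
rewrite (big_morph f (@gmulfM _ _ f) (multiplicative1 f)).
have fX g k : f (g ^+ k) = f g ^+ k.
  elim: k => [|k IHk]; first by rewrite !expg0 multiplicative1.
  by rewrite !expgS gmulfM IHk.
rewrite [z in RHS]row_sum_delta.
apply: eq_bigr => j _; have ltj := ltn_ord j.
rewrite fX fE; [|lia..].
have -> : length_class (n - 1) (j.+2 - 1) = delta_mx 0%R j.
  by apply/rowP=> l; rewrite !mxE eqxx subSS subn0 eqSS eq_sym.
have [->|->] : z ord0 j = 0%R \/ z ord0 j = 1%R.
- by case: (z _ _) => -[|[|//]] lt; [left | right]; apply: val_inj.
- by rewrite GRing.scale0r expg0.
by rewrite GRing.scale1r expg1.
Qed.

(** The images of the generators generate the quotient F_2^(n-1), whose
    minimal number of generators is its rank as an elementary abelian group. *)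
Lemma cactus_generators n (Y : finType) (R : word Y -> word Y -> Prop)
    (t : Y -> cactus n) :
  presents R t -> n - 1 <= #|Y|.
Proof.
move=> Rt; have [f fE] := cactus_length n.
have gen := presents_generators Rt (cactus_length_surj fE).
have abE := mx_Fp_abelem 1 (n - 1) (isT : prime 2).
have := grank_min [set f (t x) | x : Y].
rewrite gen (grank_abelian (abelem_abelian abE)) (rank_abelem abE).
rewrite cardsT card_mx card_Fp // mul1n pfactorK // => le.
by apply: leq_trans le _; apply: leq_imset_card.
Qed.

Local Close Scope group_scope.

Theorem theorem1 (n : nat) (hn : 2 <= n) :
  presents (@prefix_rel n)
    (fun i : {i : nat | prefix_idx n i} => csigma n 1 (sval i))
  /\ (forall (Y : finType) (R : word Y -> word Y -> Prop) (t : Y -> cactus n),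
        presents R t -> n - 1 <= #|Y|).
Proof.
split; first exact: prefix_presents_cactus.
by move=> Y R t; apply: cactus_generators.
Qed.
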